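(* Let $\Gamma=\mathrm{Cay}(G,S)$ be a connected arc-transitive inner-automorphic Cayley graph, where $G=\langle a,b\mid a^n=b^2=1,\ a^b=a^{-1}\rangle\cong \mathrm{D}_{2n}$ with $n\ge 2$. Then one of the following holds: (i) $\Gamma\cong \mathsf{K}_{n,n}$, and either $S=\{a^ib\mid 1\le i\le n\}$, or $n=2k$ is even and $S=\{a^{2i}b,\,a^{2i+1}\mid 1\le i\le k\}$ or $S=\{a^{2i+1}b,\,a^{2i+1}\mid 1\le i\le k\}$; (ii) $\Gamma\cong \mathsf{K}_{n,n}-n\mathsf{K}_2$ with $n=2k$ even and $k\ge 3$ odd, and either $S=\{a^{2i}b,\,a^{2j+1}\mid 1\le i,j\le k,\ 2j+1\ne k\}$ or $S=\{a^{2i+1}b,\,a^{2j+1}\mid 1\le i,j\le k,\ 2j+1\neq k\}$; (iii) $\Gamma\cong \mathsf{K}_{2n}$ and $S=G\setminus\{1\}$; (iv) $\Gamma\cong \mathsf{K}_{m[t]}$ and $S=G\setminus H$ and $H$ is the unique subgroup of $\langle a\rangle$ of order $t$, where $m\ge 3$, $t\ge 2$ and $mt=2n$; (v) $\Gamma$ is a bipartite graph with biparts $\langle a^2,b\rangle$ and $\langle a^2,b\rangle a$, of girth $4$ and diameter $3$, and $(a^\pi b)^G\subset S\subseteq (a^\pi b)^G\cup\langle a^2\rangle a$ with $n=2k$, $\pi\in\{0,1\}$ and $0<|\langle a^2\rangle a\cap S|\le k-2$.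
   Context: All graphs are finite, simple, connected and undirected. $\mathrm{D}_{2n}$ is the dihedral group of order $2n$, $x^y=y^{-1}xy$, and $g^G$ is the conjugacy class of $g$ in $G$. For a finite group $G$ and $S\subseteq G\setminus\{1\}$ with $S=S^{-1}$, $\mathrm{Cay}(G,S)$ is the graph with vertex set $G$ in which $x,y$ are adjacent if and only if $yx^{-1}\in S$. It is inner-automorphic if $S$ is a union of conjugacy classes of $G$. A graph is arc-transitive if its full automorphism group is transitive on the set of arcs (ordered pairs of adjacent vertices). $\mathsf{K}_{2n}$ is the complete graph of order $2n$, $\mathsf{K}_{n,n}$ is the complete bipartite graph of order $2n$, $\mathsf{K}_{n,n}-n\mathsf{K}_2$ is $\mathsf{K}_{n,n}$ minus a matching (of $n$ edges), and $\mathsf{K}_{m[t]}$ is the complete multipartite graph consisting of $m\ge 3$ parts of size $t\ge 2$. The biparts of a bipartite graph are the two parts of its bipartition.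
   Formalization: In (v) the biparts are taken as ⟨a²,a^{1−π}b⟩ and ⟨a²,a^{1−π}b⟩a: as printed for π=1, but ⟨a²,ab⟩ and ⟨a²,ab⟩a for π=0, since then b∈S makes 1 and b adjacent and the printed biparts are impossible. *)

(* Defs.v *)
From mathcomp Require Import all_boot all_fingroup all_solvable.

Set Implicit Arguments.
Unset Strict Implicit.
Unset Printing Implicit Defensive.

(* A graph on a finite vertex type V is its adjacency relation e : rel V. *)

Section Graphs.

Variable V : finType.
Implicit Types (e : rel V) (A B : {set V}).

Definition connected_graph e : Prop := forall x y, connect e x y.

Definition graph_aut e : {set {perm V}} :=
  [set p : {perm V} | [forall x, forall y, e (p x) (p y) == e x y]].

Definition arc_transitive e : Prop :=
  forall u v u' v', e u v -> e u' v' ->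
  exists p : {perm V}, [/\ p \in graph_aut e, p u = u' & p v = v'].

Definition graph_isom (W : finType) e (f : rel W) : Prop :=
  exists2 h : V -> W, bijective h & forall x y, f (h x) (h y) = e x y.

Definition bipartite_with_parts e A B : Prop :=
  [/\ A :|: B = setT, [disjoint A & B]
    & forall x y, e x y -> (x \in A) = (y \in B)].

Definition has_cycle_of_length e (l : nat) : Prop :=
  exists c : seq V, [/\ size c = l, 3 <= l, uniq c & path.cycle e c].

Definition girth_is e (g : nat) : Prop :=
  has_cycle_of_length e g /\ forall l, has_cycle_of_length e l -> g <= l.

Definition walk_of_length e x y (d : nat) : Prop :=
  exists p : seq V, [/\ path e x p, last x p = y & size p = d].

Definition distance_is e x y (d : nat) : Prop :=
  walk_of_length e x y d /\ forall l, walk_of_length e x y l -> d <= l.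

Definition diameter_is e (D : nat) : Prop :=
  (forall x y, exists2 d, distance_is e x y d & d <= D) /\
  (exists x y, distance_is e x y D).

End Graphs.

Definition complete_graph (n : nat) : rel 'I_n := fun x y => x != y.

(* K_{m[t]}: the first coordinate is the part. *)
Definition complete_multipartite (m t : nat) : rel ('I_m * 'I_t) :=
  fun x y => x.1 != y.1.

(* K_{n,n} *)
Definition complete_bipartite (n : nat) : rel (bool * 'I_n) :=
  fun x y => x.1 != y.1.

(* K_{n,n} - n K_2 *)
Definition complete_bipartite_minus_matching (n : nat) : rel (bool * 'I_n) :=
  fun x y => (x.1 != y.1) && (x.2 != y.2).

Section Cayley.

Local Open Scope group_scope.

Variable gT : finGroupType.
Implicit Types (a b : gT) (S : {set gT}).

Definition cayley S : rel gT := fun x y => y * x^-1 \in S.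

Definition connection_set S : Prop := 1 \notin S /\ S^-1 = S.

Definition union_of_classes S : Prop :=
  exists2 C : {set {set gT}}, C \subset classes [set: gT] & S = cover C.

(* gT = <a, b | a^n, b^2, a^b = a^-1>: a group of order 2n generated by a and b
   satisfying these relations is presented by them on these generators. *)
Definition dihedral_presented (n : nat) a b : Prop :=
  [/\ [set: gT] \isog 'D_(2 * n), <<[set a; b]>> = [set: gT],
      a ^+ n = 1, b ^+ 2 = 1 & a ^ b = a^-1].

End Cayley.

(* Main.v *)
Require Import Defs.
From mathcomp Require Import all_boot all_fingroup all_solvable.
From mathcomp Require Import zify.

Set Implicit Arguments.
Unset Strict Implicit.
Unset Printing Implicit Defensive.

Local Open Scope group_scope.

(** Arc-transitivity enters through a count: the number of common neighbours of 1
    and s, namely #|S :&: S :* s|, is the same for all s in S.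

    Reflections a^i b and a^(i+2) b are conjugate, so S contains all
    reflections, or none, or n = 2k and S contains exactly one of the two
    classes <a^2>b and <a^2>ab. Having none is excluded by connectedness, since
    S would lie in <a>.

    If S contains all reflections, its complement D lies in <a>, so D and D b
    are disjoint. As #|D :&: D s| differs from #|S :&: S s| by a constant, D and
    D s are disjoint for every s in S; this says that no quotient of elements
    of D lies in S, that is, D is a subgroup H of <a>
    (arc_transitive_compl_group). Two elements are then adjacent exactly when
    they lie in different cosets of H, and the graph is complete multipartite:
    K_{n,n} for H = <a>, K_{2n} for H = 1, and K_{m[t]} otherwise.

    If S contains one class <a^2>x with x = a^r b, put C = <a> and P = <a^2, x>.
    These two subgroups of index 2 split the group into <a^2>, <a^2>x, <a^2>a
    and <a^2>xa. Comparing the common neighbours along the edges of S in the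
    first three cosets shows that S avoids <a^2> (connection_set_misses_setI).
    So the graph is bipartite, with one part equal to the third subgroup
    A = <a^2> :|: <a^2>xa of index 2, and S consists of <a^2>x and a nonempty
    part T of <a^2>a. If T is everything, the graph is K_{n,n}. If T misses one
    element, that element is an involution because T is closed under inversion;
    it is therefore a^k with k odd, and the graph is K_{n,n} minus a perfect
    matching. Otherwise T has at most k - 2 elements, and girth 4 and diameter 3
    follow directly, as two elements in the same part always have a common
    neighbour. *)

(** * Cayley graphs and counting common neighbours *)

Section CayleyGraphs.

Variable gT : finGroupType.
Implicit Types (S : {set gT}) (H A C P : {group gT}) (g h s x y z : gT).

Lemma connected_cayley_subG S P :
  connected_graph (cayley S) -> S \subset P -> P :=: [set: gT].
Proof.
move=> conn /subsetP sSP; apply/setP=> y; rewrite inE.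
have /connectP [p] := conn 1 y.
elim: p 1 (group1 P) => [|z p IHp] x Px /=; first by move=> _ ->.
case/andP=> /sSP Pzx; apply: IHp.
by rewrite -(mulgKV x z) groupM.
Qed.

Lemma connection_setV S g : connection_set S -> (g^-1 \in S) = (g \in S).
Proof. by case=> _ {2}<-; rewrite inE. Qed.

(** The neighbourhood of g is S :* g, so an automorphism carrying the arc (1, s)
    to the arc (1, t) carries one intersection onto the other. *)
Lemma card_common_neighbours S s t :
    arc_transitive (cayley S) -> s \in S -> t \in S ->
  #|S :&: S :* s| = #|S :&: S :* t|.
Proof.
move=> arcS.
have le u v : u \in S -> v \in S -> #|S :&: S :* u| <= #|S :&: S :* v|.
  move=> Su Sv; have edge w : w \in S -> cayley S 1 w by rewrite /cayley invg1 mulg1.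
  have [p [autp p1 pu]] := arcS _ _ _ _ (edge _ Su) (edge _ Sv).
  have ep x y : cayley S (p x) (p y) = cayley S x y.
    by move: autp; rewrite inE => /forallP/(_ x)/forallP/(_ y)/eqP.
  rewrite -(card_imset (mem (S :&: S :* u)) (@perm_inj _ p)); apply: subset_leq_card.
  apply/subsetP=> _ /imsetP [w /setIP [Sw Suw] ->]; rewrite mem_rcoset in Suw.
  have := ep 1 w; have := ep u w.
  by rewrite /cayley p1 pu invg1 !mulg1 Suw Sw inE mem_rcoset => -> ->.
by move=> Ss St; apply/eqP; rewrite eqn_leq !le.
Qed.

(** Write D = ~: S. By inclusion and exclusion #|S :&: S :* s| and
    #|D :&: D :* s| differ by a constant, so disjointness of D and D :* b for one
    b in S spreads to all s in S. If x and y are in D but x * y is in S, then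
    y = x^-1 * (x * y) would be in D :&: D :* (x * y). *)
Lemma arc_transitive_compl_group S b :
    connection_set S -> arc_transitive (cayley S) -> b \in S ->
    [disjoint ~: S & ~: S :* b] ->
  group_set (~: S).
Proof.
move=> cS arcS Sb disb.
have card_compl s :
  #|S :&: S :* s| + (#|~: S| + #|~: S|) = #|gT| + #|~: S :&: ~: S :* s|.
  have -> : S :&: S :* s = ~: (~: S :|: ~: S :* s).
    by apply/setP=> g; rewrite !inE !mem_rcoset !inE negb_or !negbK.
  rewrite -{2}(card_rcoset (~: S) s) -cardsUI addnA; congr addn.
  by rewrite addnC cardsC.
have disS s : s \in S -> ~: S :&: ~: S :* s = set0.
  move=> Ss; apply/eqP; rewrite -cards_eq0; apply/eqP.
  have := card_compl s; rewrite (card_common_neighbours arcS Ss Sb) card_compl.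
  by rewrite (disjoint_setI0 disb) cards0 => /addnI <-.
apply/group_setP; split=> [|x y]; first by rewrite inE; case: cS.
rewrite !inE => nSx nSy; apply/negP=> Sxy.
have /setP/(_ y) := disS _ Sxy.
by rewrite !inE mem_rcoset invMg mulKVg !inE (connection_setV _ cS) nSx nSy.
Qed.

(** Membership in a subgroup of index 2 is a homomorphism to the booleans, which
    turns all coset computations below into case analysis. *)
Lemma index2M A g h : #|[set: gT] : A| = 2 ->
  (g * h \in A) = ((g \in A) == (h \in A)).
Proof.
move=> iA; case: (boolP (g \in A)) => [Ag | nAg]; first by rewrite groupMl.
case: (boolP (h \in A)) => [Ah | nAh]; first by rewrite groupMr // (negPf nAg).
have: h^-1 \in A :* g.
  suff -> : A :* g = ~: A by rewrite inE groupV.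
  apply/eqP; rewrite eqEcard; apply/andP; split.
    by apply/subsetP=> x /rcosetP [u Au ->]; rewrite inE groupMl.
  rewrite card_rcoset -(leq_add2l #|A|) cardsC -cardsT -(Lagrange (subsetT A)).
  by rewrite iA muln2 addnn.
by rewrite mem_rcoset -invMg groupV => ->.
Qed.

(** * Models of the complete (multi)partite graphs *)

(** An element is encoded by its coset H :* x, and by its offset in H from the
    representative of that coset. *)
Lemma coset_coordinates H (I : finType) t :
    #|I| = #|[set: gT] : H| -> #|H| = t ->
  exists2 h : gT -> I * 'I_t, bijective h
    & forall x y, ((h x).1 == (h y).1) = (y * x^-1 \in H).
Proof.
move=> cI cH.
have rcT x : H :* x \in rcosets H [set: gT].
  by rewrite mem_rcosets; apply/mulsgP; exists 1 x; rewrite ?mul1g.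
have rH x : x * (repr (H :* x))^-1 \in H.
  case: (repr_rcosetP H x) => u Hu.
  by rewrite invMg mulKVg groupV.
pose f x := enum_val (cast_ord (esym cI) (enum_rank_in (rcT 1) (H :* x))) : I.
pose k x := cast_ord cH (enum_rank_in (group1 H) (x * (repr (H :* x))^-1)).
have fP x y : (f x == f y) = (y * x^-1 \in H).
  rewrite -mem_rcoset; apply/eqP/idP=> [|/rcoset_eqP eqxy].
    move/enum_val_inj/cast_ord_inj/(enum_rank_in_inj (rcT x) (rcT y)) => eqxy.
    by rewrite eqxy rcoset_refl.
  by rewrite /f eqxy.
exists (fun x => (f x, k x)) => [|x y]; last exact: fP.
apply: inj_card_bij => [x y eqh|].
  have /eqP := congr1 fst eqh; rewrite fP -mem_rcoset => /rcoset_eqP eqxy.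
  have /cast_ord_inj/(enum_rank_in_inj (rH x) (rH y)) := congr1 snd eqh.
  by rewrite eqxy => /mulIg.
by rewrite card_prod card_ord cI -cH mulnC Lagrange ?subsetT ?cardsT.
Qed.

Lemma graph_isom_multipartite H m t :
    #|[set: gT] : H| = m -> #|H| = t ->
  graph_isom (cayley ([set: gT] :\: H)) (@complete_multipartite m t).
Proof.
move=> iH cH; have [|h bijh hP] := @coset_coordinates H 'I_m t _ cH.
  by rewrite card_ord.
by exists h => // x y; rewrite /complete_multipartite hP /cayley !inE andbT.
Qed.

Lemma graph_isom_bipartite A n :
    #|[set: gT] : A| = 2 -> #|A| = n ->
  graph_isom (cayley (~: A)) (@complete_bipartite n).
Proof.
move=> iA cA; have [|h bijh hP] := @coset_coordinates A bool n _ cA.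
  by rewrite card_bool.
by exists h => // x y; rewrite /complete_bipartite hP /cayley !inE.
Qed.

Lemma graph_isom_complete n : #|gT| = n ->
  graph_isom (cayley ([set: gT] :\ 1)) (@complete_graph n).
Proof.
move=> <-; exists enum_rank; first exact: (Bijective enum_rankK enum_valK).
move=> x y; rewrite /complete_graph (inj_eq enum_rank_inj) /cayley !inE andbT.
by rewrite eq_sym -eq_mulgV1.
Qed.

(** The matching consists of the pairs {g, z * g}; the second coordinate names
    such a pair by its unique element in A. *)
Lemma graph_isom_bipartite_minus_matching A z n :
    #|[set: gT] : A| = 2 -> #|A| = n -> z \notin A -> z^-1 = z ->
  graph_isom (cayley (~: A :\ z)) (@complete_bipartite_minus_matching n).
Proof.
move=> iA cA nAz zV.
pose q g := if g \in A then g else z * g.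
have qA g : q g \in A.
  by rewrite /q; case: ifP => // nAg; rewrite index2M // nAg (negPf nAz).
pose h g := (g \in A, cast_ord cA (enum_rank_in (group1 A) (q g))).
have hP x y : ((h x).2 == (h y).2) = (q x == q y).
  rewrite (inj_eq (@cast_ord_inj _ _ _)).
  by apply/eqP/eqP=> [/(enum_rank_in_inj (qA x) (qA y))|->].
exists h => [|x y].
  apply: inj_card_bij => [x y|]; last first.
    rewrite card_prod card_bool card_ord -cA mulnC -iA.
    by rewrite Lagrange ?subsetT ?cardsT.
  move=> eqh; have eq1 : (x \in A) = (y \in A) by case: eqh.
  have /eqP : (h x).2 == (h y).2 by rewrite eqh.
  move/eqP; rewrite hP /q eq1 => /eqP.
  by case: ifP => // _ /mulgI.
rewrite /complete_bipartite_minus_matching hP /cayley !inE index2M // groupV /=.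
rewrite (eq_sym (y \in A)); case: (eqVneq (x \in A)) => [_|neqxy] /=.
  by rewrite andbF.
rewrite andbT; congr negb.
rewrite /q; apply/eqP/eqP; case: (x \in A) neqxy; case: (y \in A) => //= _.
- by move=> ->; rewrite invMg mulKVg.
- by move=> <-; rewrite mulgK.
- by move=> eqz; rewrite -zV -eqz invMg invgK mulgKV.
- by move=> <-; rewrite mulgKV.
Qed.

(** * Connection sets and pairs of subgroups of index two *)

(** Let T = S :&: (C :&: P). The common neighbours of 1 and x are T and T :* x,
    so every edge has 2 #|T| of them. For s in S and in C :\: P the common
    neighbours of 1 and s lie in T :|: T :* s, hence fill it, so T :* s is
    contained in S. If some t were in T, then 1 and t would have all of P :\: C
    and of T :* s as common neighbours; this is too many, since T is smaller
    than C :&: P, as it avoids 1. *)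
Lemma connection_set_misses_setI S C P s x :
    #|[set: gT] : C| = 2 -> #|[set: gT] : P| = 2 ->
    connection_set S -> arc_transitive (cayley S) ->
    S :\: C = P :\: C -> x \in P :\: C -> s \in S -> s \in C :\: P ->
  S :&: (C :&: P) = set0.
Proof.
move=> iC iP cS arcS defSC /setDP [Px nCx] Ss /setDP [Cs nPs].
have S1 : 1 \notin S by case: cS.
have SC g : g \notin C -> (g \in S) = (g \in P).
  by move=> nCg; move/setP/(_ g): defSC; rewrite !inE nCg.
have Sx : x \in S by rewrite SC.
set T := S :&: (C :&: P); apply/eqP; rewrite -cards_eq0; apply/negPn/negP.
rewrite cards_eq0 => /set0Pn [t Tt]; have /setIP [St /setIP [Ct Pt]] := Tt.
have cardTU g : g \notin C :&: P -> #|T :|: T :* g| = (#|T| + #|T|)%N.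
  move=> nMg; rewrite -{2}(card_rcoset T g) -cardsUI.
  suff -> : T :&: T :* g = set0 by rewrite cards0 addn0.
  apply/setP=> h; rewrite [RHS]inE; apply/negP=> /setIP [/setIP [_ Mh]].
  rewrite mem_rcoset => /setIP [_]; move: nMg Mh; rewrite !inE !index2M // !groupV.
  by case: (g \in C); case: (g \in P); case: (h \in C); case: (h \in P).
have SPC g h :
    (h \notin C) = (g \in C) -> (g * h^-1 \in S) = ((g \in P) == (h \in P)).
  by move=> eqC; rewrite SC index2M // groupV // -eqC; case: (h \in C).
have neighx : S :&: S :* x = T :|: T :* x.
  apply/setP=> g; rewrite !inE !mem_rcoset !inE !index2M // !groupV Px (negPf nCx).
  case: (boolP (g \in C)) => Cg.
    rewrite SPC ?Cg // Px; case: (g \in P); by rewrite ?andbF ?andbT ?orbF.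
  rewrite (SC g Cg); case: (g \in P); by rewrite ?andbF ?andbT.
(* The inclusion becomes an equality because both sides have 2 #|T| elements. *)
have neighCP u : u \in S -> u \in C -> u \notin P -> S :&: S :* u = T :|: T :* u.
  move=> Su Cu nPu; apply/eqP; rewrite eqEcard cardTU ?inE ?(negPf nPu) ?andbF //.
  rewrite (card_common_neighbours arcS Su Sx) neighx cardTU ?inE ?(negPf nCx) //.
  rewrite leqnn andbT; apply/subsetP=> g; rewrite !inE !mem_rcoset !inE.
  rewrite !index2M // !groupV Cu (negPf nPu).
  case: (boolP (g \in C)) => Cg.
    by case: (g \in P) => /andP [-> ->].
  rewrite (SC g Cg) SC ?index2M // groupV ?Cu ?(negPf Cg) // (negPf nPu).
  by case: (g \in P).
have ltTM : #|T| < #|P :\: C|.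
  rewrite -(card_rcoset T x); apply/proper_card/properP; split.
    apply/subsetP=> g; rewrite mem_rcoset !inE !index2M // !groupV Px (negPf nCx).
    by case: (g \in C); case: (g \in P); rewrite ?andbF.
  by exists x; rewrite ?mem_rcoset ?mulgV !inE ?Px ?nCx // (negPf S1).
have subt : (P :\: C) :|: T :* s \subset S :&: S :* t.
  apply/subsetP=> g; rewrite !inE mem_rcoset => /orP [/andP [nCg Pg]|Tgs].
    rewrite SC // Pg mem_rcoset SC ?index2M // groupV ?Ct ?(negPf nCg) //.
    by rewrite Pg Pt.
  (* g is itself in S :&: (C :\: P), so T is contained in S :* g. *)
  have : g \in S :&: S :* s by rewrite neighCP // inE mem_rcoset Tgs orbT.
  case/setIP=> Sg _; rewrite Sg mem_rcoset -(connection_setV _ cS) invMg invgK.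
  move: Tgs; rewrite !inE !index2M // !groupV Cs (negPf nPs) eqb_id eqbF_neg.
  case/and3P=> _ Cg nPg.
  have : t \in S :&: S :* g.
    by rewrite neighCP // inE Tt.
  by rewrite inE mem_rcoset => /andP [].
have disj : (P :\: C) :&: T :* s = set0.
  apply/setP=> g; rewrite !inE mem_rcoset !inE !index2M // !groupV Cs.
  by case: (g \in C); rewrite ?andbF.
have := subset_leq_card subt.
rewrite (card_common_neighbours arcS St Sx) neighx cardTU ?inE ?(negPf nCx) //.
have := cardsUI (P :\: C) (T :* s); rewrite disj cards0 addn0 => ->.
by rewrite card_rcoset leq_add2r leqNgt ltTM.
Qed.

(** * Girth and diameter of bipartite Cayley graphs *)

Section Bipartite.

Variables (S : {set gT}) (A : {group gT}).
Hypothesis iA : #|[set: gT] : A| = 2.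
Hypothesis sSA : S \subset ~: A.

Lemma cayley_edge_index2 x y : cayley S x y -> (x \in A) != (y \in A).
Proof.
move=> /(subsetP sSA); rewrite inE index2M // groupV.
by rewrite eq_sym.
Qed.

Lemma cayley_path_index2 x p : path (cayley S) x p ->
  (last x p * x^-1 \in A) = ~~ odd (size p).
Proof.
elim: p x => [|z p IHp] x /=; first by rewrite mulgV group1.
case/andP=> /(subsetP sSA); rewrite inE => nAzx /IHp IHz.
have -> : last z p * x^-1 = (last z p * z^-1) * (z * x^-1).
  by rewrite mulgA mulgKV.
by rewrite index2M // (negPf nAzx) IHz; case: odd.
Qed.

Lemma cayley_bipartite_with_parts a :
  a \notin A -> bipartite_with_parts (cayley S) A (A :* a).
Proof.
move=> nAa; have inAa g : (g \in A :* a) = (g \notin A).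
  by rewrite mem_rcoset index2M // groupV (negPf nAa); case: (g \in A).
split.
- by apply/setP=> g; rewrite !inE inAa orbN.
- by rewrite disjoint_subset; apply/subsetP=> g Ag; rewrite inE /= inAa Ag.
- move=> x y /cayley_edge_index2; rewrite inAa.
  by case: (x \in A); case: (y \in A).
Qed.

(** The cycle is 1, s1, t, s2; a bipartite graph has no triangle. *)
Lemma cayley_girth4 t s1 s2 :
    connection_set S -> t \in A -> t != 1 ->
    s1 \in S :&: S :* t -> s2 \in S :&: S :* t -> s1 != s2 ->
  girth_is (cayley S) 4.
Proof.
move=> cS At t1 /setIP [Ss1]; rewrite mem_rcoset => Ss1t.
case/setIP=> Ss2; rewrite mem_rcoset => Ss2t neqs.
have SnA g : g \in S -> g \notin A by move/(subsetP sSA); rewrite inE.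
split=> [|l [c [<- c3 uc]]].
  exists [:: 1; s1; t; s2]; split=> //=.
    rewrite !inE !negb_or neqs (eq_sym 1 t) t1 !andbT !(eq_sym 1).
    have neqA g h : g \in S -> h \in A -> g != h.
      by move=> Sg Ah; apply: contraNneq (SnA g Sg) => ->.
    by rewrite !(eq_sym t) !neqA.
  rewrite /cayley invg1 mulg1 mul1g Ss1 Ss2t !connection_setV // Ss2 !andbT.
  by rewrite -(connection_setV _ cS) invMg invgK.
case: c c3 uc => [|x [|y [|z [|w p]]]] // _ _ /cayley_path_index2.
by rewrite /= mulgV group1.
Qed.

(** The hypothesis on A gives a walk of length 2 between any two vertices in the
    same part, and one more step through s reaches the other part. The vertices
    1 and v lie in different parts and are not adjacent, so by parity their
    distance is at least 3. *)
Lemma cayley_diameter3 s v :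
    (forall g, g \in A -> exists2 h, h \in S & g * h^-1 \in S) ->
    s \in S -> v \notin A -> v \notin S ->
  diameter_is (cayley S) 3.
Proof.
move=> nbrA Ss nAv nSv.
have SnA g : g \in S -> g \notin A by move/(subsetP sSA); rewrite inE.
have walkA x y l : walk_of_length (cayley S) x y l -> (y * x^-1 \in A) = ~~ odd l.
  by case=> p [/cayley_path_index2 + <- <-].
have walk2 x y : y * x^-1 \in A -> walk_of_length (cayley S) x y 2.
  case/nbrA=> h Sh Sgh; exists [:: h * x; y]; split=> //=.
  by rewrite /cayley mulgK Sh invMg mulgA Sgh.
have walk3 x y : y * x^-1 \notin A -> walk_of_length (cayley S) x y 3.
  move=> nAg; have [|p [pathp lastp sizep]] := walk2 (s * x) y.
    by rewrite invMg mulgA index2M // (negPf nAg) groupV (negPf (SnA s Ss)).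
  by exists (s * x :: p); rewrite /= lastp sizep /cayley mulgK Ss pathp.
have dist3 x y : y * x^-1 \notin A -> y * x^-1 \notin S ->
    distance_is (cayley S) x y 3.
  move=> nAg nSg; split=> [|l]; first exact: walk3.
  case: l => [|[|[|l]]] // w; try by move: nAg; rewrite (walkA _ _ _ w).
  case: w => [[|z [|z' p]]] [] //=; rewrite andbT => Szx eqz _.
  by move: nSg; rewrite -eqz => /negP[].
split=> [x y|]; last by exists 1, v; apply: dist3; rewrite invg1 mulg1.
case: (boolP (y * x^-1 \in A)) => Ag.
  case: (eqVneq x y) => [<-|neqxy]; first by exists 0; split=> //; exists nil.
  exists 2 => //; split=> [|l w]; first exact: walk2.
  have := walkA _ _ _ w; rewrite Ag; case: l w => [|[|l]] // [[|z p] [] //= _ eqxy _ _].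
  by rewrite eqxy eqxx in neqxy.
case: (boolP (y * x^-1 \in S)) => Sg; last by exists 3 => //; apply: dist3.
exists 1%N => //; split=> [|l w]; first by exists [:: y]; rewrite /= /cayley Sg.
by have := walkA _ _ _ w; rewrite (negPf Ag); case: l {w}.
Qed.

End Bipartite.

(** A is the third subgroup of index 2 above C :&: P. Quotients of an element of
    C :&: P by x, and of an element outside C and P by s, land in P :\: C, which
    is contained in S: this yields the common neighbours within A. *)
Lemma cayley_girth4_diameter3 S A C P x s t v :
    #|[set: gT] : A| = 2 -> #|[set: gT] : C| = 2 -> #|[set: gT] : P| = 2 ->
    (forall g, (g \in A) = ((g \in C) == (g \in P))) ->
    connection_set S -> S \subset ~: A -> P :\: C \subset S ->
    x \in P :\: C -> s \in S :&: (C :\: P) -> v \in (C :\: P) :\: S ->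
    t \in C :&: P -> t != 1 ->
  girth_is (cayley S) 4 /\ diameter_is (cayley S) 3.
Proof.
move=> iA iC iP memA cS sSA /subsetP sPC PCx /setIP [Ss].
have PCq g h : (g * h^-1 \in P :\: C) =
    ((g \in C) != (h \in C)) && ((g \in P) == (h \in P)).
  by rewrite inE !index2M // !groupV.
have Sx := sPC x PCx; case/setDP: (PCx) => Px nCx.
case/setDP=> Cs nPs /setDP [/setDP [Cv nPv] nSv] /setIP [Ct Pt] t1; split.
  apply: (cayley_girth4 iA sSA cS (t := t) (s1 := x) (s2 := t * x)) => //.
  - by rewrite memA Ct Pt.
  - by rewrite inE Sx mem_rcoset sPC // PCq (negPf nCx) Px Ct Pt.
  - rewrite inE mem_rcoset !sPC ?PCq ?inE ?index2M //;
      by rewrite (negPf nCx) Px Ct Pt.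
  - by rewrite -{1}(mul1g x) (inj_eq (mulIg x)) eq_sym.
apply: (cayley_diameter3 iA sSA _ Ss _ nSv); last by rewrite memA Cv (negPf nPv).
move=> g; rewrite memA => /eqP eqCP.
have [Cg | nCg] := boolP (g \in C).
  by exists x => //; apply: sPC; rewrite PCq -eqCP Cg (negPf nCx) Px.
by exists s => //; apply: sPC; rewrite PCq -eqCP (negPf nCg) Cs (negPf nPs).
Qed.

End CayleyGraphs.

(** * Dihedral groups *)

Section DihedralGroups.

Variable gT : finGroupType.
Implicit Types (S : {set gT}) (g h s x y z : gT).

(** The exponents run from 1 to q rather than from 0 to q - 1, so that i = q
    produces y itself. *)
Lemma imset_expg_rcoset x y q : x ^+ q = 1 -> 0 < q ->
  [set x ^+ i * y | i : 'I_q.+1 & 1 <= i] = <[x]> :* y.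
Proof.
move=> xq q0; apply/setP=> g; apply/imsetP/rcosetP => [[i _ ->]|[_ /cycleP [j ->] ->]].
  by exists (x ^+ i); rewrite ?mem_cycle.
have [i [i1 iq ij]] : exists i, [/\ 1 <= i, i < q.+1 & x ^+ i = x ^+ j].
  case: (posnP (j %% q)) => [j0|j1].
    by exists q; split=> //; rewrite xq -(expg_mod _ xq) j0.
  exists (j %% q); split=> //; last exact: expg_mod.
  by rewrite ltnS ltnW // ltn_pmod.
by exists (Ordinal iq); rewrite ?inE //= ij.
Qed.

Lemma mem_union_of_classesJ S g h : union_of_classes S -> (g ^ h \in S) = (g \in S).
Proof.
case=> C /subsetP sC ->; rewrite /cover.
have closed u v : u \in \bigcup_(B in C) B -> u ^ v \in \bigcup_(B in C) B.
  case/bigcupP=> B CB uB; apply/bigcupP; exists B => //.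
  have /imsetP [w _ defB] := sC B CB; rewrite defB in uB *.
  by rewrite -(class_eqP uB) memJ_class ?inE.
by apply/idP/idP=> [/(closed _ h^-1)|/closed //]; rewrite conjgK.
Qed.

Variables (n : nat) (a b : gT).
Hypothesis n_gt1 : 1 < n.
Hypothesis dihG : dihedral_presented n a b.

Lemma card_dihedral_presented : #|gT| = (2 * n)%N.
Proof.
case: dihG => isoG _ _ _ _; rewrite -cardsT (card_isog isoG) mul2n.
by rewrite card_dihedral.
Qed.

Lemma dihedral_factorization : [set: gT] = <[a]> * <[b]>.
Proof.
case: dihG => _ genG _ _ ab; rewrite -norm_joinEr ?joing_idl ?joing_idr ?genG //.
by rewrite cycle_subG; apply/normP; rewrite -cycleJ ab cycleV.
Qed.

(** The group is <a> * <b>, where a has order at most n and b at most 2; its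
    order 2n forces equality and a trivial intersection. *)
Lemma dihedral_order : #[a] = n /\ b \notin <[a]>.
Proof.
case: (dihG) => _ _ an b2 _.
have oa : #[a] <= n by apply: dvdn_leq; rewrite ?order_dvdn ?an //; lia.
have ob : #[b] <= 2 by apply: dvdn_leq; rewrite ?order_dvdn ?b2.
have := mul_cardG <[a]> <[b]>; rewrite -dihedral_factorization cardsT.
rewrite card_dihedral_presented -!orderE => cardG.
have cap0 : 0 < #|<[a]> :&: <[b]>| by apply: cardG_gt0.
have leM : #[a] * #[b] <= n * 2 by apply: leq_mul.
have n2 : 0 < 2 * n by lia.
have cap1 : #|<[a]> :&: <[b]>| = 1%N.
  apply/eqP; rewrite eqn_leq cap0 andbT -(leq_pmul2l n2) -cardG muln1.
  by rewrite (mulnC 2).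
split.
  move: cardG ob n_gt1 oa; rewrite cap1; move: #[a] #[b] => u v; nia.
apply/negP=> Cb; have capb : <[a]> :&: <[b]> = <[b]>.
  by apply/setIidPr; rewrite cycle_subG.
have ob1 : #[b] = 1%N by rewrite orderE -capb.
move: cardG; rewrite cap1 ob1 => cardG.
by move: cardG oa n_gt1; move: #[a] => u; lia.
Qed.

Lemma dihedral_order_rotation : #[a] = n. Proof. by case: dihedral_order. Qed.

Lemma dihedral_expg_eq i j : (a ^+ i == a ^+ j) = (i == j %[mod n]).
Proof. by rewrite eq_expg_mod_order dihedral_order_rotation. Qed.

Lemma dihedral_index_rotations : #|[set: gT] : <[a]>| = 2.
Proof.
rewrite -divgS ?subsetT // cardsT card_dihedral_presented -orderE.
by rewrite dihedral_order_rotation mulnK //; lia.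
Qed.

Lemma mem_rotations i (j : bool) : (a ^+ i * b ^+ j \in <[a]>) = ~~ j.
Proof.
rewrite groupMl ?mem_cycle //; case: j; rewrite ?group1 // expg1.
by have [_ /negPf] := dihedral_order.
Qed.

Lemma dihedral_normal_form g : exists i, exists j : bool, g = a ^+ i * b ^+ j.
Proof.
have: g \in <[a]> * <[b]> by rewrite -dihedral_factorization.
case/mulsgP=> _ _ /cycleP [i ->] /cycleP [j ->] ->; exists i, (odd j).
case: dihG => _ _ _ b2 _; congr (_ * _).
by rewrite -{1}(odd_double_half j) expgD -mul2n expgM b2 expg1n mulg1.
Qed.

Lemma expg_conj_reflection i j : (a ^+ i) ^ (a ^+ j * b) = (a ^+ i)^-1.
Proof.
case: dihG => _ _ _ _ ab; rewrite conjgM conjXg (conjgE a (a ^+ j)).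
by rewrite (commuteX j (commute_refl a)) mulKg conjXg ab expgVn.
Qed.

Lemma reflection_rotation i : b * a ^+ i = (a ^+ i)^-1 * b.
Proof.
have := expg_conj_reflection i 0; rewrite mul1g => <-.
case: dihG => _ _ _ b2 _.
have bb : b * b = 1 by rewrite -b2.
have bV : b^-1 = b by apply/eqP; rewrite eq_invg_mul bb.
by rewrite conjgE -!mulgA bb mulg1 bV.
Qed.

Lemma reflection_sqr i : (a ^+ i * b) ^+ 2 = 1.
Proof.
case: dihG => _ _ _ b2 _.
by rewrite expgS expg1 -mulgA (mulgA b) reflection_rotation -mulgA mulKVg -b2.
Qed.

Lemma conj_reflection i l : (a ^+ (i + 2 * l) * b) ^ (a ^+ l) = a ^+ i * b.
Proof.
rewrite conjgE -(mulgA (a ^+ _)) reflection_rotation !mulgA; congr (_ * b).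
by rewrite mulnC muln2 -addnn addnA addnC expgD mulKg expgD mulgK.
Qed.

(** Conjugation by a^l shifts the exponent of a reflection by 2l. *)
Lemma reflections_of_same_parity S i :
  union_of_classes S -> (a ^+ i * b \in S) = (a ^+ (odd i) * b \in S).
Proof.
move=> innS; rewrite -{1}(odd_double_half i) -mul2n.
by rewrite -(mem_union_of_classesJ _ (a ^+ i./2) innS) conj_reflection.
Qed.

(** * Connection sets containing all reflections *)

(** The complement of S lies in <a>, hence is disjoint from its translate by b
    and is a subgroup. The three cases are that it is <a>, trivial, or neither. *)
Lemma all_reflections_trichotomy S :
    arc_transitive (cayley S) ->
    connection_set S -> (forall i, a ^+ i * b \in S) ->
  [\/ graph_isom (cayley S) (@complete_bipartite n) /\
        S = [set a ^+ i * b | i : 'I_n.+1 & 1 <= i],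
     graph_isom (cayley S) (@complete_graph (2 * n)) /\ S = [set: gT] :\ 1
   | exists m t : nat, exists H : {group gT},
     [/\ 3 <= m, 2 <= t & (m * t = 2 * n)%N] /\
     [/\ graph_isom (cayley S) (@complete_multipartite m t),
         S = [set: gT] :\: H,
         H \subset <[a]>,
         #|H| = t
       & forall K : {group gT}, K \subset <[a]> -> #|K| = t -> K = H]].
Proof.
move=> arcS cS Srefl.
have Sb : b \in S by rewrite -(mul1g b) (Srefl 0).
have subD : ~: S \subset <[a]>.
  apply/subsetP=> g; have [i [j ->]] := dihedral_normal_form g.
  by rewrite mem_rotations inE; case: j; rewrite // Srefl.
have disj : [disjoint ~: S & ~: S :* b].
  apply/pred0P=> g /=; apply/negP=> /andP [/(subsetP subD) Cg].
  rewrite mem_rcoset => /(subsetP subD); rewrite groupMl // groupV.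
  by apply/negP; case: dihedral_order.
pose H := Group (arc_transitive_compl_group cS arcS Sb disj).
have HC : H \subset <[a]> := subD.
have defS : S = [set: gT] :\: H by rewrite setTD /= setCK.
have [defH | neqHC] := eqVneq (H : {set gT}) <[a]>.
  apply: Or31; have {2}-> : S = ~: <[a]> by rewrite -defH setCK.
  split.
    rewrite defS setTD defH.
    apply: graph_isom_bipartite; first exact: dihedral_index_rotations.
    by rewrite -orderE dihedral_order_rotation.
  case: (dihG) => _ _ an _ _; rewrite imset_expg_rcoset //; last by lia.
  apply/setP=> g; rewrite inE mem_rcoset.
  rewrite index2M ?dihedral_index_rotations // groupV.
  by have [_ /negPf ->] := dihedral_order; case: (g \in _).
have [H1 | nH1] := eqVneq (H : {set gT}) 1.
  apply: Or32; rewrite defS H1; split=> //.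
  by apply: graph_isom_complete; rewrite card_dihedral_presented.
apply: Or33; exists #|[set: gT] : H|, #|H|, H.
have indexH : (#|[set: gT] : <[a]>| * #|<[a]> : H|)%N = #|[set: gT] : H|.
  by rewrite Lagrange_index ?subsetT.
split; split=> //.
- rewrite -indexH dihedral_index_rotations.
  suff : 1 < #|<[a]> : H| by lia.
  by rewrite indexg_gt1; apply: contra neqHC => sCH; rewrite eqEsubset HC.
- by rewrite cardG_gt1.
- by rewrite mulnC Lagrange ?subsetT // cardsT card_dihedral_presented.
- by rewrite {1}defS; apply: graph_isom_multipartite.
move=> K KC cK; apply/group_inj/eqP.
by rewrite (eq_subG_cyclic (cycle_cyclic a)) ?cK.
Qed.

(** * Connection sets containing one class of reflections *)

Section EvenDihedral.

Variable k : nat.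
Hypothesis def_n : n = (2 * k)%N.

(* For r = 0 and r = 1 these are the two subgroups of index 2 other than <a>. *)
Local Notation P r := <<[set a ^+ 2; a ^+ r * b]>>.

Lemma order_sqr_rotation : #[a ^+ 2] = k.
Proof.
by rewrite orderXdiv dihedral_order_rotation def_n ?dvdn_mulr // mulKn.
Qed.

Lemma sqr_rotation_expg : (a ^+ 2) ^+ k = 1.
Proof. by case: dihG => _ _ an _ _; rewrite -expgM -def_n. Qed.

(** P r is the product of <a^2>, of order k, and of the group of order 2
    generated by a reflection. *)
Lemma index_even_subgroup r : #|[set: gT] : P r| = 2.
Proof.
have ybar : a ^+ r * b \notin <[a]> by rewrite (mem_rotations r true).
have cardP : #|P r| = n.
  have -> : P r = <[a ^+ 2]> <*> <[a ^+ r * b]> by rewrite joing_idl joing_idr.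
  rewrite norm_joinEr; last first.
    by rewrite cycle_subG; apply/normP; rewrite -cycleJ expg_conj_reflection cycleV.
  have oy : #[a ^+ r * b] = 2.
    by apply: nt_prime_order (reflection_sqr r) _ => //; apply: contraNneq ybar => ->.
  rewrite TI_cardMg -?orderE ?oy ?order_sqr_rotation ?def_n ?(mulnC 2) //.
  rewrite setIC; apply: prime_TIg; first by rewrite -orderE oy.
  rewrite cycle_subG; apply: contra ybar; apply/subsetP.
  by rewrite cycle_subG mem_cycle.
rewrite -divgS ?subsetT // cardsT card_dihedral_presented cardP mulnK //; lia.
Qed.

(** P r is the kernel of the sign character with a -> -1 and b -> (-1)^r. *)
Lemma mem_even_subgroup r i (j : bool) :
  (a ^+ i * b ^+ j \in P r) = (~~ odd i == ~~ (odd r && j)).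
Proof.
have iP := index_even_subgroup r.
have Pa2 : a ^+ 2 \in P r by rewrite mem_gen ?set21.
have Py : a ^+ r * b \in P r by rewrite mem_gen ?set22.
have nPa : a \notin P r.
  apply/negP=> Pa; have eqCP : <[a]> == P r.
    have := Lagrange (subsetT <<[set a ^+ 2; a ^+ r * b]>>).
    rewrite iP cardsT card_dihedral_presented mulnC => /(congr1 half).
    rewrite !mul2n !doubleK => cardP.
    by rewrite eqEcard cycle_subG Pa cardP -orderE dihedral_order_rotation /=.
  by move: Py; rewrite -(eqP eqCP) (mem_rotations r true).
have Pai l : (a ^+ l \in P r) = ~~ odd l.
  elim: l => [|l IHl]; first by rewrite group1.
  by rewrite expgS index2M // IHl (negPf nPa) /=; case: odd.
have Pb : (b \in P r) = ~~ odd r.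
  by move: Py; rewrite index2M // Pai; case: odd; case: (b \in _).
by rewrite index2M // Pai; case: j; rewrite ?Pb ?andbT // group1 andbF.
Qed.

Lemma mem_even_subgroup_rotation r i : (a ^+ i \in P r) = ~~ odd i.
Proof.
rewrite -[X in X \in _]mulg1 -[1]/(b ^+ false).
by rewrite mem_even_subgroup andbF eqb_id.
Qed.

Lemma rotations_even_subgroup r :
  <[a]> :\: P r = <[a ^+ 2]> :* a.
Proof.
apply/setP=> g; apply/setDP/rcosetP => [[/cycleP [i ->]]|[_ /cycleP [i ->] ->]].
  rewrite mem_even_subgroup_rotation negbK => oddi.
  exists (a ^+ 2 ^+ i./2); rewrite ?mem_cycle // -expgM -expgSr.
  by rewrite mul2n -{1}(odd_double_half i) oddi.
rewrite -expgM -expgSr mem_cycle; split=> //.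
by rewrite mem_even_subgroup_rotation /= mul2n odd_double.
Qed.

Lemma even_subgroup_reflections r : r <= 1 ->
  P r :\: <[a]> = <[a ^+ 2]> :* (a ^+ r * b).
Proof.
move=> r1; apply/setP=> g; apply/setDP/rcosetP => [|[_ /cycleP [i ->] ->]].
  have [i [j ->]] := dihedral_normal_form g.
  rewrite mem_even_subgroup mem_rotations negbK => -[+ jT]; rewrite jT andbT.
  move=> /eqP/negb_inj eqir; exists (a ^+ 2 ^+ i./2); rewrite ?mem_cycle //.
  rewrite -expgM mulgA -expgD; congr (a ^+ _ * _).
  by rewrite -{1}(odd_double_half i) eqir; case: r r1 {eqir} => [|[|]] // _; lia.
rewrite -expgM mulgA -expgD -[b]expg1.
rewrite (mem_rotations _ true) (mem_even_subgroup _ _ true) oddD oddM andbT.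
by rewrite eqxx.
Qed.

Lemma third_even_subgroup r g : r <= 1 ->
  (g \in P (1 - r)) = ((g \in <[a]>) == (g \in P r)).
Proof.
have [i [j ->]] := dihedral_normal_form g.
rewrite !mem_even_subgroup mem_rotations.
by case: r => [|[|]] // _; case: j; case: odd.
Qed.

Lemma reflection_class r : r <= 1 ->
  (a ^+ r * b) ^: [set: gT] = <[a ^+ 2]> :* (a ^+ r * b).
Proof.
move=> r1; apply/eqP; rewrite eqEsubset; apply/andP; split.
  have nor (A : {group gT}) :
      #|[set: gT] : A| = 2 -> forall h g, (g ^ h \in A) = (g \in A).
    move=> iA h g; apply: memJ_norm; apply: (subsetP (normal_norm _)) (in_setT h).
    exact: index2_normal (subsetT A) iA.
  apply/subsetP=> _ /imsetP [h _ ->]; rewrite -even_subgroup_reflections // inE.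
  rewrite !nor ?index_even_subgroup ?dihedral_index_rotations //.
  by rewrite (mem_rotations r true) mem_gen ?set22.
apply/subsetP=> _ /rcosetP [_ /cycleP [l ->] ->]; apply/imsetP.
exists (a ^+ l)^-1; rewrite ?inE //; apply: (canRL (conjgK _)).
by rewrite -expgM mulgA -expgD addnC conj_reflection.
Qed.

(** Connectedness provides an element of S outside P r, which can only be an odd
    rotation; the count of common neighbours then removes the even rotations. *)
Lemma one_class_bipartite S r :
    r <= 1 -> connected_graph (cayley S) -> arc_transitive (cayley S) ->
    connection_set S -> (forall i, (a ^+ i * b \in S) = (odd i == odd r)) ->
  [/\ S = (S :&: <[a ^+ 2]> :* a) :|: <[a ^+ 2]> :* (a ^+ r * b),
      S \subset ~: P (1 - r)
    & S :&: <[a ^+ 2]> :* a != set0].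
Proof.
move=> r1 conn arcS cS Srefl.
have iC := dihedral_index_rotations; have iP := index_even_subgroup r.
have defSC : S :\: <[a]> = P r :\: <[a]>.
  apply/setP=> g; have [i [j ->]] := dihedral_normal_form g.
  rewrite !inE mem_rotations mem_even_subgroup; case: j => //=.
  by rewrite expg1 Srefl andbT; case: odd; case: odd.
have xPC : a ^+ r * b \in P r :\: <[a]>.
  by rewrite even_subgroup_reflections // rcoset_refl.
have nPS : ~~ (S \subset P r).
  apply/negP=> sSP; have /(connected_cayley_subG conn) defP := sSP.
  by move: iP; rewrite defP indexgg.
have [s Ss nPs] := subsetPn nPS.
have CPs : s \in <[a]> :\: P r.
  rewrite inE nPs; apply/negPn/negP=> nCs; case/negP: nPs.
  by have /setDP [] : s \in P r :\: <[a]> by rewrite -defSC inE nCs.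
have noM := connection_set_misses_setI iC iP cS arcS defSC xPC Ss CPs.
rewrite -(rotations_even_subgroup r) -even_subgroup_reflections // -defSC.
split.
- apply/setP=> g; move/setP/(_ g): noM; rewrite !inE.
  by case: (g \in S); case: (g \in <[a]>); case: (g \in P r).
- apply/subsetP=> g Sg; rewrite inE third_even_subgroup //.
  move/setP/(_ g): noM; move/setP/(_ g): defSC; rewrite !inE Sg.
  by case: (g \in <[a]>); case: (g \in P r).
- by apply/set0Pn; exists s; rewrite inE Ss.
Qed.

Lemma imset_even_reflections : 0 < k ->
  [set a ^+ (2 * i) * b | i : 'I_k.+1 & 1 <= i] = <[a ^+ 2]> :* (a ^+ 0 * b).
Proof.
move=> k0; rewrite mul1g -(imset_expg_rcoset b sqr_rotation_expg) //.
by apply: eq_imset => i; rewrite expgM.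
Qed.

Lemma imset_odd_reflections : 0 < k ->
  [set a ^+ (2 * i + 1) * b | i : 'I_k.+1 & 1 <= i] = <[a ^+ 2]> :* (a ^+ 1 * b).
Proof.
move=> k0; rewrite -(imset_expg_rcoset _ sqr_rotation_expg) //.
by apply: eq_imset => i; rewrite expgD expgM mulgA.
Qed.

Lemma imset_odd_rotations : 0 < k ->
  [set a ^+ (2 * i + 1) | i : 'I_k.+1 & 1 <= i] = <[a ^+ 2]> :* a.
Proof.
move=> k0; rewrite -(imset_expg_rcoset _ sqr_rotation_expg) //.
by apply: eq_imset => i; rewrite expgD expgM.
Qed.

(** The exponents 2j + 1 run from 3 to 2k + 1, and the bound on k makes 2k + 1
    incongruent to k modulo 2k; so a^(2j + 1) = a^k only when 2j + 1 = k. *)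
Lemma imset_odd_rotations_minus : 2 < k ->
  [set a ^+ (2 * j + 1) | j : 'I_k.+1 & (1 <= j) && (2 * j + 1 != k)%N]
    = <[a ^+ 2]> :* a :\ a ^+ k.
Proof.
move=> k2; rewrite -imset_odd_rotations; last by lia.
have eqak (j : 'I_k.+1) : 1 <= j -> (a ^+ (2 * j + 1) == a ^+ k) = (2 * j + 1 == k)%N.
  move=> j1; rewrite dihedral_expg_eq def_n; have := ltn_ord j; rewrite ltnS.
  case: (ltngtP j k) => // [ltjk _|-> _].
    by rewrite !modn_small //; lia.
  rewrite addnC modnDr !modn_small; lia.
apply/setP=> g; rewrite !inE; apply/imsetP/andP => [[j]|[ngk /imsetP [j]]].
  rewrite inE => /andP [j1 jk] ->; rewrite eqak //; split=> //.
  by apply/imsetP; exists j; rewrite ?inE.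
rewrite inE => j1 defg; exists j => //.
by rewrite inE j1 -eqak // -defg.
Qed.

Lemma involution_odd_rotation z :
  z \in <[a ^+ 2]> :* a -> z^-1 = z -> z = a ^+ k /\ odd k.
Proof.
rewrite -(rotations_even_subgroup 0) => /setDP [/cycleP [i ->]].
rewrite mem_even_subgroup_rotation negbK => oddi /eqP.
rewrite eq_invg_mul -expgD -(expg0 a) dihedral_expg_eq def_n mod0n addnn -mul2n.
rewrite -/(dvdn _ _) dvdn_pmul2l // => /dvdnP [q defi].
move: oddi; rewrite defi oddM => /andP [oddq oddk]; split=> //; apply/eqP.
rewrite dihedral_expg_eq def_n -(odd_double_half q) oddq mulnDl mul1n addnC.
by rewrite -mul2n -mulnA (mulnCA 2) modnMDl.
Qed.

(** The alternatives are that S omits none, exactly one, or at least two of the k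
    elements of the coset <a^2>a. *)
Lemma one_class_alternative S r :
    r <= 1 -> connected_graph (cayley S) -> arc_transitive (cayley S) ->
    connection_set S -> (forall i, (a ^+ i * b \in S) = (odd i == odd r)) ->
  [\/ graph_isom (cayley S) (@complete_bipartite n) /\
       S = <[a ^+ 2]> :* (a ^+ r * b) :|: <[a ^+ 2]> :* a,
     graph_isom (cayley S) (@complete_bipartite_minus_matching n) /\
       [/\ 2 < k, odd k &
           S = <[a ^+ 2]> :* (a ^+ r * b) :|: (<[a ^+ 2]> :* a :\ a ^+ k)]
   | [/\ bipartite_with_parts (cayley S) (P (1 - r)) (P (1 - r) :* a),
         girth_is (cayley S) 4
       & diameter_is (cayley S) 3] /\
     [/\ (a ^+ r * b) ^: [set: gT] \proper S,
         S \subset ((a ^+ r * b) ^: [set: gT]) :|: (<[a ^+ 2]> :* a),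
         0 < #|(<[a ^+ 2]> :* a) :&: S|
       & #|(<[a ^+ 2]> :* a) :&: S| <= k - 2]].
Proof.
move=> r1 conn arcS cS Srefl.
have [defS sSA T1] := one_class_bipartite r1 conn arcS cS Srefl.
have iC := dihedral_index_rotations; have iP := index_even_subgroup r.
have iA := index_even_subgroup (1 - r).
have memA g := third_even_subgroup g r1.
rewrite (reflection_class r1); move: defS T1 memA.
rewrite -(rotations_even_subgroup r) -even_subgroup_reflections //.
set Ma := _ :\: P r; set Mx := P r :\: _ => defS T1 memA.
have defA : ~: P (1 - r) = Mx :|: Ma.
  apply/setP=> g; rewrite inE memA !inE.
  by case: (g \in <[a]>); case: (g \in <<_>>).
have cA : #|P (1 - r)| = n.
  have := Lagrange (subsetT <<[set a ^+ 2; a ^+ (1 - r) * b]>>).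
  rewrite iA cardsT card_dihedral_presented mulnC => /(congr1 half).
  by rewrite !mul2n !doubleK.
have [R0 | [z Rz]] := set_0Vmem (Ma :\: S).
  apply: Or31; have eqS : S = Mx :|: Ma.
    by rewrite defS setUC; congr (_ :|: _); apply/setIidPr; rewrite -setD_eq0 R0.
  by split=> //; rewrite eqS -defA; apply: graph_isom_bipartite.
have cMa : #|Ma| = k.
  by rewrite /Ma rotations_even_subgroup card_rcoset -orderE order_sqr_rotation.
have [Maz nSz] := setDP Rz.
have T1gt0 : 0 < #|Ma :&: S| by rewrite card_gt0 setIC.
have [R1 | R2] := leqP #|Ma :\: S| 1.
  have defR : Ma :\: S = [set z].
    by apply/eqP; rewrite eq_sym eqEcard sub1set Rz cards1.
  (* The omitted set is closed under inversion and has a single element. *)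
  have zV : z^-1 = z.
    apply/set1P; rewrite -defR inE connection_setV // nSz.
    by move: Maz; rewrite !inE !groupV.
  have [defz oddk] : z = a ^+ k /\ odd k.
    by apply: involution_odd_rotation; rewrite // -(rotations_even_subgroup r).
  have k3 : 2 < k.
    have := cardsID S Ma; rewrite defR cards1 cMa => cardk.
    move: T1gt0 oddk; rewrite -cardk; case: #|_ :&: _| => // u _.
    by case: u => [|[|]].
  have SMa : S :&: Ma = Ma :\ z.
    apply/setP=> g; move/setP/(_ g): defR; rewrite !inE => <-.
    by case: (g \in S); case: (g \in <[a]>); case: (g \in <<_>>).
  have eqS : S = Mx :|: (Ma :\ z) by rewrite {1}defS SMa setUC.
  apply: Or32; split; last by rewrite -defz.
  have -> : S = ~: P (1 - r) :\ z.
    rewrite defA eqS setDUl; congr (_ :|: _); apply/esym/setDidPl.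
    rewrite disjoint_sym disjoints1; move: Maz; rewrite !inE.
    by case: (z \in <[a]>); case: (z \in <<_>>).
  by apply: graph_isom_bipartite_minus_matching; rewrite // -in_setC defA inE Maz orbT.
have cT : #|Ma :&: S| <= k - 2 by rewrite -cMa -(cardsID S Ma) -addnBA // leq_addr.
have k3 : 2 < k by rewrite -subn_gt0 (leq_trans T1gt0).
have sMxS : Mx \subset S by rewrite defS subsetUr.
have [s Ts] := set0Pn _ T1.
have PCx : a ^+ r * b \in Mx by rewrite /Mx even_subgroup_reflections ?rcoset_refl.
have CPa2 : a ^+ 2 \in <[a]> :&: P r by rewrite inE mem_cycle mem_gen ?set21.
have a2_neq1 : a ^+ 2 != 1 by rewrite -order_gt1 order_sqr_rotation ltnW.
have nAa : a \notin P (1 - r).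
  by rewrite -[X in X \notin _]expg1 mem_even_subgroup_rotation.
have [girth4 diam3] :=
  cayley_girth4_diameter3 iA iC iP memA cS sSA sMxS PCx Ts Rz CPa2 a2_neq1.
apply: Or33; split; split=> //.
- exact: (cayley_bipartite_with_parts iA sSA nAa).
- apply/properP; split=> //; have /setIP [Ss /setDP [Cs _]] := Ts.
  by exists s; rewrite // inE Cs.
- by rewrite {1}defS setUC setUS // subsetIr.
Qed.

End EvenDihedral.
End DihedralGroups.

Theorem theorem1p1 (gT : finGroupType) (n : nat) (a b : gT) (S : {set gT})
    (hn : 2 <= n)
    (hG : dihedral_presented n a b)
    (hS : connection_set S)
    (hconn : connected_graph (cayley S))
    (harc : arc_transitive (cayley S))
    (hinn : union_of_classes S) :
  (* (i) *)
  (graph_isom (cayley S) (@complete_bipartite n) /\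
   (S = [set a ^+ i * b | i : 'I_n.+1 & 1 <= i] \/
    exists2 k : nat, n = (2 * k)%N &
      S = [set a ^+ (2 * i) * b | i : 'I_k.+1 & 1 <= i]
          :|: [set a ^+ (2 * i + 1) | i : 'I_k.+1 & 1 <= i] \/
      S = [set a ^+ (2 * i + 1) * b | i : 'I_k.+1 & 1 <= i]
          :|: [set a ^+ (2 * i + 1) | i : 'I_k.+1 & 1 <= i]))
  \/
  (* (ii) *)
  (graph_isom (cayley S) (@complete_bipartite_minus_matching n) /\
   exists k : nat,
     [/\ n = (2 * k)%N, 3 <= k, odd k &
         S = [set a ^+ (2 * i) * b | i : 'I_k.+1 & 1 <= i]
             :|: [set a ^+ (2 * j + 1) | j : 'I_k.+1
                   & (1 <= j) && (2 * j + 1 != k)%N] \/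
         S = [set a ^+ (2 * i + 1) * b | i : 'I_k.+1 & 1 <= i]
             :|: [set a ^+ (2 * j + 1) | j : 'I_k.+1
                   & (1 <= j) && (2 * j + 1 != k)%N]])
  \/
  (* (iii) *)
  (graph_isom (cayley S) (@complete_graph (2 * n)) /\ S = [set: gT] :\ 1)
  \/
  (* (iv) *)
  (exists m t : nat, exists H : {group gT},
     [/\ 3 <= m, 2 <= t & (m * t = 2 * n)%N] /\
     [/\ graph_isom (cayley S) (@complete_multipartite m t),
         S = [set: gT] :\: H,
         H \subset <[a]>,
         #|H| = t
       & forall K : {group gT}, K \subset <[a]> -> #|K| = t -> K = H])
  \/
  (* (v); a ^+ (1 - pi) * b is b for pi = 1 and a * b for pi = 0: when pi = 0,
     b is in S, so 1 and b are adjacent and cannot lie in the same part *)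
  (exists k pi : nat,
     [/\ n = (2 * k)%N & pi = 0%N \/ pi = 1%N] /\
     [/\ bipartite_with_parts (cayley S)
           <<[set a ^+ 2; a ^+ (1 - pi) * b]>>
           (<<[set a ^+ 2; a ^+ (1 - pi) * b]>> :* a),
         girth_is (cayley S) 4
       & diameter_is (cayley S) 3] /\
     [/\ (a ^+ pi * b) ^: [set: gT] \proper S,
         S \subset ((a ^+ pi * b) ^: [set: gT]) :|: (<[a ^+ 2]> :* a),
         0 < #|(<[a ^+ 2]> :* a) :&: S|
       & #|(<[a ^+ 2]> :* a) :&: S| <= k - 2]).
Proof.
have reflP i := reflections_of_same_parity hG i hinn.
have [allS | notall] := boolP ((b \in S) && (a * b \in S)).
  have Srefl i : a ^+ i * b \in S.
    by rewrite reflP; case/andP: allS => Sb Sab; case: odd; rewrite ?mul1g.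
  case: (all_reflections_trichotomy hn hG harc hS Srefl) => [[]|[]|] *.
  - by left; split=> //; left.
  - by right; right; left.
  - by right; right; right; left.
have someS : (b \in S) || (a * b \in S).
  apply/negPn/negP; rewrite negb_or => /andP [nSb nSab].
  have [_ /negP[]] := dihedral_order hn hG.
  suff -> : <[a]> = [set: gT] by rewrite inE.
  apply: (connected_cayley_subG hconn); apply/subsetP=> g.
  have [i [j ->]] := dihedral_normal_form hG g.
  rewrite (mem_rotations hn hG); case: j => //; rewrite expg1 reflP.
  by case: odd; rewrite ?mul1g ?(negPf nSb) ?(negPf nSab).
(* The boolean is the exponent: S contains the class of a^r b and not the other. *)
pose r : nat := a * b \in S.
have r1 : r <= 1 by rewrite /r; case: (_ \in _).
have Srefl i : (a ^+ i * b \in S) = (odd i == odd r).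
  rewrite reflP /r oddb; move: someS notall.
  by case: odd; rewrite ?mul1g; case: (b \in S); case: (a * b \in S).
(* Since a^n b = b, both classes would coincide if n were odd. *)
have [k def_n] : exists k, n = (2 * k)%N.
  exists n./2; rewrite mul2n -{1}(odd_double_half n) addnC -[RHS]addn0; congr addn.
  have := Srefl n; case: hG => _ _ -> _ _; have := Srefl 0; rewrite mul1g => -> /=.
  by case: odd; case: odd.
have k0 : 0 < k by lia.
have MxE : <[a ^+ 2]> :* (a ^+ r * b)
             = [set a ^+ (2 * i) * b | i : 'I_k.+1 & 1 <= i] \/
           <[a ^+ 2]> :* (a ^+ r * b)
             = [set a ^+ (2 * i + 1) * b | i : 'I_k.+1 & 1 <= i].
  rewrite (imset_even_reflections hG def_n k0) (imset_odd_reflections hG def_n k0).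
  by case: (r) r1 => [|[|]]; [left | right |].
case: (one_class_alternative hn hG def_n r1 hconn harc hS Srefl).
- case=> isoS eqS; left; split=> //; right; exists k => //.
  rewrite (imset_odd_rotations hG def_n k0).
  by case: MxE => <-; [left | right].
- case=> isoS [k3 oddk eqS]; right; left; split=> //; exists k; split=> //.
  rewrite (imset_odd_rotations_minus hn hG def_n k3).
  by case: MxE => <-; [left | right].
- case=> bip cls; right; right; right; right; exists k, r; split=> //; split=> //.
  by case: (r) r1 => [|[|]]; [left | right |].
Qed.
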